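(* Let $\mathcal{C}$ be a triangulated category endowed with a weight structure $w$ with heart $\underline{Hw}$. Let $S$ be a set of morphisms of the category $\underline{Hw}$ that satisfies the left Ore condition in $\underline{Hw}$, and let $\mathcal{D}=\langle \mathrm{Cone}(S)\rangle$ be the full triangulated subcategory of $\mathcal{C}$ strongly generated by the cones of the elements of $S$. Then the triple $(\mathcal{C},w,\mathcal{D})$ satisfies the left weight lifting property.
   Context: Weight structures. A weight structure $w$ on a triangulated category $\mathcal{C}$ is a pair of classes $\mathcal{C}_{w\le 0},\mathcal{C}_{w\ge 0}\subset \mathrm{Obj}\,\mathcal{C}$ such that: (i) both classes are closed under retracts in $\mathcal{C}$; (ii) $\mathcal{C}_{w\le 0}\subset \mathcal{C}_{w\le 0}[1]$ and $\mathcal{C}_{w\ge 0}[1]\subset \mathcal{C}_{w\ge 0}$; (iii) $\mathcal{C}(X,Y)=0$ for all $X\in\mathcal{C}_{w\le 0}$, $Y\in \mathcal{C}_{w\ge 0}[1]$; (iv) for every object $M$ there is a distinguished triangle $X\to M\to Y\to X[1]$ with $X\in \mathcal{C}_{w\le 0}$, $Y\in\mathcal{C}_{w\ge 0}[1]$. The heart $\underline{Hw}$ is the full subcategory of $\mathcal{C}$ with object class $\mathcal{C}_{w=0}=\mathcal{C}_{w\ge 0}\cap\mathcal{C}_{w\le 0}$. Strong generation. For a class $D$ of objects, $\langle D\rangle$ is the smallest full triangulated subcategory of $\mathcal{C}$ (closed under isomorphisms) containing $D$; it is said to be strongly generated by $D$. Left Ore condition. A class $S$ of morphisms of a category $\mathcal{A}$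 satisfies the left Ore condition if for any $g\in\mathcal{A}(X,Y)\cap S$ and any $u\in\mathcal{A}(X,Z)$ there exist an object $T$ and morphisms $f\in\mathcal{A}(Y,T)$, $s\in\mathcal{A}(Z,T)\cap S$ with $f\circ g=s\circ u$. (No cancellation property is required.) Descent and weight lifting. Let $\mathcal{D}\subset\mathcal{C}$ be a full triangulated subcategory (assumed essentially small), $\mathcal{C}'=\mathcal{C}/\mathcal{D}$ the Verdier quotient, $L:\mathcal{C}\to\mathcal{C}'$ the localization functor. One says that $w$ descends to $\mathcal{C}'$ if there is a weight structure $w'$ on $\mathcal{C}'$ such that $L(\mathcal{C}_{w\le 0})\subset\mathcal{C}'_{w'\le 0}$ and $L(\mathcal{C}_{w\ge 0})\subset\mathcal{C}'_{w'\ge 0}$; such a $w'$ is unique, and $\mathcal{C}'_{w'\le 0}$ (resp. $\mathcal{C}'_{w'\ge 0}$) consists of all retracts in $\mathcal{C}'$ of elements of $L(\mathcal{C}_{w\le 0})$ (resp. $L(\mathcal{C}_{w\ge 0})$). The triple $(\mathcal{C},w,\mathcal{D})$ satisfies the left weight lifting property if $w$ descends to a weight structure $w'$ on $\mathcal{C}'$ and for any object $X$ of $\mathcal{C}$ with $L(X)\in\mathcal{C}'_{w'\ge 0}$ there exists a distinguished triangle $T\to X\to X_{\ge 0}\to T[1]$ in $\mathcal{C}$ with $T\in\mathrm{Obj}\,\mathcal{D}$ and $X_{\ge 0}\in\mathcal{C}_{w\ge 0}$. *)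

(* Defs.v *)
From HB Require Import structures.
From mathcomp Require Import all_boot all_algebra.

Set Implicit Arguments.
Unset Strict Implicit.
Unset Printing Implicit Defensive.

Import GRing.Theory.
Local Open Scope ring_scope.

Record category := Category {
  obj :> Type;
  mor : obj -> obj -> Type;
  idmor : forall X : obj, mor X X;
  compm : forall X Y Z : obj, mor Y Z -> mor X Y -> mor X Z;
  compm1 : forall (X Y : obj) (f : mor X Y), compm f (idmor X) = f;
  comp1m : forall (X Y : obj) (f : mor X Y), compm (idmor Y) f = f;
  compmA : forall (X Y Z U : obj) (h : mor Z U) (g : mor Y Z) (f : mor X Y),
    compm h (compm g f) = compm (compm h g) f }.

Arguments mor {c} X Y.
Arguments idmor {c} X.
Arguments compm {c X Y Z} g f.

Notation "g '\c' f" := (compm g f) (at level 40, left associativity).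

Definition is_iso (C : category) (X Y : C) (f : mor X Y) : Prop :=
  exists g : mor Y X, g \c f = idmor X /\ f \c g = idmor Y.

Definition isomorphic (C : category) (X Y : C) : Prop :=
  exists f : mor X Y, is_iso f.

Definition retract_of (C : category) (X Y : C) : Prop :=
  exists (i : mor X Y) (p : mor Y X), p \c i = idmor X.

Definition full_subcategory (C : category) (P : C -> Prop) : category :=
  @Category {X : C | P X}
    (fun X Y => mor (sval X) (sval Y))
    (fun X => idmor (sval X))
    (fun X Y Z g f => g \c f)
    (fun X Y f => compm1 f)
    (fun X Y f => comp1m f)
    (fun X Y Z U h g f => compmA h g f).

Definition morphism_class (C : category) := forall X Y : C, mor X Y -> Prop.

Definition left_ore (C : category) (S : morphism_class C) : Prop :=
  forall (X Y Z : C) (g : mor X Y) (u : mor X Z), S X Y g ->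
  exists (T : C) (f : mor Y T) (s : mor Z T), S Z T s /\ f \c g = s \c u.

Record functor (C D : category) := Functor {
  fobj :> C -> D;
  fmap : forall X Y : C, mor X Y -> mor (fobj X) (fobj Y);
  fmap1 : forall X : C, fmap (idmor X) = idmor (fobj X);
  fmapM : forall (X Y Z : C) (g : mor Y Z) (f : mor X Y),
    fmap (g \c f) = fmap g \c fmap f }.

Arguments fmap {C D} f {X Y} _ : rename.

Definition idF (C : category) : functor C C :=
  @Functor C C id (fun _ _ f => f) (fun _ => erefl) (fun _ _ _ _ _ => erefl).

Definition compF (C D E : category) (G : functor D E) (F : functor C D) :
    functor C E :=
  @Functor C E (fun X => G (F X)) (fun _ _ f => fmap G (fmap F f))
    (fun X => etrans (congr1 (fmap G) (fmap1 F X)) (fmap1 G (F X)))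
    (fun X Y Z g f =>
       etrans (congr1 (fmap G) (fmapM F g f)) (fmapM G (fmap F g) (fmap F f))).

Definition natural (C D : category) (F G : functor C D)
    (a : forall X : C, mor (F X) (G X)) : Prop :=
  forall (X Y : C) (f : mor X Y), a Y \c fmap F f = fmap G f \c a X.

Arguments natural {C D} F G a.

Definition naturally_isomorphic (C D : category) (F G : functor C D) : Prop :=
  exists a : forall X : C, mor (F X) (G X),
    natural F G a /\ forall X : C, is_iso (a X).

Definition is_equivalence (C D : category) (F : functor C D) : Prop :=
  exists G : functor D C,
    naturally_isomorphic (compF G F) (idF C) /\
    naturally_isomorphic (compF F G) (idF D).

Definition inverts (C D : category) (W : morphism_class C) (F : functor C D) :
    Prop :=
  forall (X Y : C) (f : mor X Y), W X Y f -> is_iso (fmap F f).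

(** The 2-categorical universal property of C[W^-1]: precomposition with [L] is
    an equivalence from functors on [C'] to functors on [C] inverting [W]. *)
Definition is_localization (C C' : category) (W : morphism_class C)
    (L : functor C C') : Prop :=
  [/\ inverts W L,
      forall (E : category) (F : functor C E), inverts W F ->
        exists G : functor C' E, naturally_isomorphic (compF G L) F
    & forall (E : category) (G H : functor C' E)
             (a : forall X : C, mor (G (L X)) (H (L X))),
        natural (compF G L) (compF H L) a ->
        exists b : forall X' : C', mor (G X') (H X'),
          [/\ natural G H b,
              forall X : C, b (L X) = a X
            & forall b' : forall X' : C', mor (G X') (H X'),
                natural G H b' -> (forall X : C, b' (L X) = a X) ->
                forall X' : C', b' X' = b X'] ].

Record preadditive_category := PreadditiveCategory {
  preadd_cat :> category;
  mor_zmod : forall X Y : preadd_cat, GRing.Zmodule (mor X Y) }.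

HB.instance Definition _ (A : preadditive_category) (X Y : A) :=
  mor_zmod X Y.

Definition is_zero (A : preadditive_category) (Z : A) : Prop :=
  (forall (X : A) (f : mor X Z), f = 0) /\ (forall (X : A) (f : mor Z X), f = 0).

Record additive_category := AdditiveCategory {
  add_cat :> preadditive_category;
  compmDl : forall (X Y Z : add_cat) (g g' : mor Y Z) (f : mor X Y),
    (g + g') \c f = g \c f + g' \c f;
  compmDr : forall (X Y Z : add_cat) (g : mor Y Z) (f f' : mor X Y),
    g \c (f + f') = g \c f + g \c f';
  has_zero_object : exists Z : add_cat, is_zero Z;
  has_biproducts : forall X Y : add_cat,
    exists (B : add_cat) (i : mor X B) (j : mor Y B) (p : mor B X) (q : mor B Y),
      [/\ p \c i = idmor X, q \c j = idmor Y, p \c j = 0, q \c i = 0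
        & i \c p + j \c q = idmor B] }.

Definition additive_functor (A B : additive_category) (F : functor A B) : Prop :=
  forall (X Y : A) (f g : mor X Y), fmap F (f + g) = fmap F f + fmap F g.

Definition triangle_iso (C : category) (T : functor C C)
    (X Y Z X' Y' Z' : C)
    (f : mor X Y) (g : mor Y Z) (h : mor Z (T X))
    (f' : mor X' Y') (g' : mor Y' Z') (h' : mor Z' (T X')) : Prop :=
  exists (a : mor X X') (b : mor Y Y') (c : mor Z Z'),
    [/\ is_iso a, is_iso b & is_iso c] /\
    [/\ b \c f = f' \c a, c \c g = g' \c b & fmap T a \c h = h' \c c].

(** The shift is an autoequivalence, not necessarily a strict automorphism. *)
Record triangulated_category := TriangulatedCategory {
  tri_cat :> additive_category;
  shift : functor tri_cat tri_cat;
  (* [dist f g h]: the triangle X -f-> Y -g-> Z -h-> X[1] is distinguished *)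
  dist : forall X Y Z : tri_cat,
    mor X Y -> mor Y Z -> mor Z (shift X) -> Prop;
  shift_additive : additive_functor shift;
  shift_equivalence : is_equivalence shift;
  dist_iso : forall (X Y Z X' Y' Z' : tri_cat)
      (f : mor X Y) (g : mor Y Z) (h : mor Z (shift X))
      (f' : mor X' Y') (g' : mor Y' Z') (h' : mor Z' (shift X')),
    dist f g h -> triangle_iso f g h f' g' h' -> dist f' g' h';
  dist_id : forall X Z : tri_cat, is_zero Z ->
    dist (idmor X) (0 : mor X Z) (0 : mor Z (shift X));
  dist_cone : forall (X Y : tri_cat) (f : mor X Y),
    exists (Z : tri_cat) (g : mor Y Z) (h : mor Z (shift X)), dist f g h;
  dist_rotate : forall (X Y Z : tri_cat)
      (f : mor X Y) (g : mor Y Z) (h : mor Z (shift X)),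
    dist f g h <-> dist g h (- fmap shift f);
  dist_fill : forall (X Y Z X' Y' Z' : tri_cat)
      (f : mor X Y) (g : mor Y Z) (h : mor Z (shift X))
      (f' : mor X' Y') (g' : mor Y' Z') (h' : mor Z' (shift X'))
      (a : mor X X') (b : mor Y Y'),
    dist f g h -> dist f' g' h' -> b \c f = f' \c a ->
    exists c : mor Z Z', c \c g = g' \c b /\ fmap shift a \c h = h' \c c;
  dist_octahedron : forall (X Y Z X' Y' Z' : tri_cat)
      (f : mor X Y) (h : mor Y Z') (l : mor Z' (shift X))
      (g : mor Y Z) (k : mor Z X') (j : mor X' (shift Y))
      (m : mor Z Y') (n : mor Y' (shift X)),
    dist f h l -> dist g k j -> dist (g \c f) m n ->
    exists (u : mor Z' Y') (v : mor Y' X'),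
      [/\ dist u v (fmap shift h \c j),
          u \c h = m \c g, n \c u = l,
          v \c m = k & j \c v = fmap shift f \c n] }.

Arguments shift {t}.
Arguments dist {t X Y Z} f g h.

Record exact_functor (C C' : triangulated_category) := ExactFunctor {
  exact_fun :> functor C C';
  exact_additive : additive_functor exact_fun;
  exact_shift : forall X : C, mor (exact_fun (shift X)) (shift (exact_fun X));
  exact_shift_natural :
    natural (compF exact_fun shift) (compF shift exact_fun) exact_shift;
  exact_shift_iso : forall X : C, is_iso (exact_shift X);
  exact_dist : forall (X Y Z : C)
      (f : mor X Y) (g : mor Y Z) (h : mor Z (shift X)),
    dist f g h ->
    dist (fmap exact_fun f) (fmap exact_fun g)
         (exact_shift X \c fmap exact_fun h) }.

(** Full subcategories closed under isomorphisms are given by their classes of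
    objects. *)
Record triangulated_subcategory (C : triangulated_category) (D : C -> Prop) :
    Prop := TriangulatedSubcategory {
  tsub_iso : forall X Y : C, isomorphic X Y -> D X -> D Y;
  tsub_zero : forall Z : C, is_zero Z -> D Z;
  tsub_shift : forall X : C, D X <-> D (shift X);
  tsub_cone : forall (X Y Z : C)
      (f : mor X Y) (g : mor Y Z) (h : mor Z (shift X)),
    dist f g h -> D X -> D Y -> D Z }.

Definition strongly_generated (C : triangulated_category) (G : C -> Prop) :
    C -> Prop :=
  fun X => forall D : C -> Prop, triangulated_subcategory D ->
    (forall Y : C, G Y -> D Y) -> D X.

Definition cone_in (C : triangulated_category) (D : C -> Prop) :
    morphism_class C :=
  fun X Y f =>
    exists (Z : C) (g : mor Y Z) (h : mor Z (shift X)), dist f g h /\ D Z.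

(** The distinguished triangles of C/D are those isomorphic to images of
    distinguished triangles of [C]; only one inclusion is stated, the other one
    being the exactness of [L]. *)
Definition is_verdier_quotient (C C' : triangulated_category) (D : C -> Prop)
    (L : exact_functor C C') : Prop :=
  is_localization (cone_in D) L /\
  forall (X' Y' Z' : C')
      (f' : mor X' Y') (g' : mor Y' Z') (h' : mor Z' (shift X')),
    dist f' g' h' ->
    exists (X Y Z : C) (f : mor X Y) (g : mor Y Z) (h : mor Z (shift X)),
      dist f g h /\
      triangle_iso (fmap L f) (fmap L g) (exact_shift L X \c fmap L h) f' g' h'.

(** The class P[1]. Since the shift need not be surjective on objects, it is
    closed under isomorphisms; for the classes of a weight structure this changes
    nothing, as these are closed under retracts. *)
Definition shift_class (C : triangulated_category) (P : C -> Prop) : C -> Prop :=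
  fun X => exists Y : C, P Y /\ isomorphic X (shift Y).

Record weight_structure (C : triangulated_category) := WeightStructure {
  w_le0 : C -> Prop;
  w_ge0 : C -> Prop;
  w_le0_retract : forall X Y : C, retract_of X Y -> w_le0 Y -> w_le0 X;
  w_ge0_retract : forall X Y : C, retract_of X Y -> w_ge0 Y -> w_ge0 X;
  w_le0_shift : forall X : C, w_le0 X -> shift_class w_le0 X;
  w_ge0_shift : forall X : C, shift_class w_ge0 X -> w_ge0 X;
  w_orthogonal : forall X Y : C, w_le0 X -> shift_class w_ge0 Y ->
    forall f : mor X Y, f = 0;
  w_decomposition : forall M : C,
    exists (X Y : C) (f : mor X M) (g : mor M Y) (h : mor Y (shift X)),
      [/\ dist f g h, w_le0 X & shift_class w_ge0 Y] }.

Definition heart (C : triangulated_category) (w : weight_structure C) :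
    category :=
  full_subcategory (fun X : C => w_ge0 w X /\ w_le0 w X).

Definition cones (C : triangulated_category) (w : weight_structure C)
    (S : morphism_class (heart w)) : C -> Prop :=
  fun Z => exists (X Y : heart w) (s : mor X Y), S X Y s /\
    exists (g : mor (sval Y) Z) (h : mor Z (shift (sval X))),
      dist (s : mor (sval X) (sval Y)) g h.

Definition descends_to (C C' : triangulated_category) (w : weight_structure C)
    (L : exact_functor C C') (w' : weight_structure C') : Prop :=
  (forall X : C, w_le0 w X -> w_le0 w' (L X)) /\
  (forall X : C, w_ge0 w X -> w_ge0 w' (L X)).

(** Meant for [L] a Verdier quotient of [C] by [D]; the weight structure [w'] is
    then unique. *)
Definition left_weight_lifting (C : triangulated_category)
    (w : weight_structure C) (D : C -> Prop) (C' : triangulated_category)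
    (L : exact_functor C C') : Prop :=
  exists w' : weight_structure C', descends_to w L w' /\
    forall X : C, w_ge0 w' (L X) ->
      exists (T X0 : C) (f : mor T X) (g : mor X X0) (h : mor X0 (shift T)),
        [/\ dist f g h, D T & w_ge0 w X0].

(* Main.v *)
(** The cone of a morphism of the heart has weights in [0, 1]. Hence the objects
    of [D] are bounded, and each is an extension of an object of [D] of weight
    at least 0 by one of weight at most 0. By this decomposition a fraction with
    source of negative weight and target of weight at least 0 vanishes, so the
    retracts of the images of the two classes form a weight structure on [C/D].

    Let [L X] have nonnegative weight and let [X -> Y -> A -> X[1]] be a
    triangle with [Y] of nonnegative and [A] of nonpositive weight. The morphism
    [A -> X[1]] dies in [C/D], so it factors through a bounded object of [D];
    therefore [X] itself is bounded below. By induction on the bound it suffices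
    to treat [X] of weight at least -1. Then [Y -> A] has a section in
    [C/D], given by a fraction [f : A -> M], [s : Y -> M] with [M] of nonnegative
    weight, and the composite [X -> Y -> M -> cone f] has its cone in [D], while
    [cone f] has nonnegative weight. *)

From Stdlib Require Import FunctionalExtensionality PropExtensionality.
From Stdlib Require Import ProofIrrelevance ClassicalEpsilon.
Require Import Defs.
From mathcomp Require Import all_boot all_algebra.

Set Implicit Arguments.
Unset Strict Implicit.
Unset Printing Implicit Defensive.

Import GRing.Theory.
Local Open Scope ring_scope.

(** * Categories and equivalences *)

Section Categories.
Variable C : category.
Implicit Types X Y Z : C.

Lemma iso_idmor X : is_iso (idmor X).
Proof. by exists (idmor X); rewrite compm1. Qed.

Lemma iso_comp X Y Z (g : mor Y Z) (f : mor X Y) :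
  is_iso g -> is_iso f -> is_iso (g \c f).
Proof.
move=> [g' [g'g gg']] [f' [f'f ff']]; exists (f' \c g'); split.
  by rewrite compmA -(compmA f') g'g compm1.
by rewrite compmA -(compmA g) ff' compm1.
Qed.

Lemma iso_fmap (D : category) (F : functor C D) X Y (f : mor X Y) :
  is_iso f -> is_iso (fmap F f).
Proof.
by move=> [g [gf fg]]; exists (fmap F g); rewrite -!fmapM gf fg !fmap1.
Qed.

Lemma isomorphic_refl X : isomorphic X X.
Proof. by exists (idmor X); apply: iso_idmor. Qed.

Lemma isomorphic_sym X Y : isomorphic X Y -> isomorphic Y X.
Proof. by move=> [f [g [gf fg]]]; exists g, f. Qed.

Lemma isomorphic_trans Y X Z :
  isomorphic X Y -> isomorphic Y Z -> isomorphic X Z.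
Proof. by move=> [f fi] [g gi]; exists (g \c f); apply: iso_comp. Qed.

Lemma isomorphic_fmap (D : category) (F : functor C D) X Y :
  isomorphic X Y -> isomorphic (F X) (F Y).
Proof. by move=> [f fi]; exists (fmap F f); apply: iso_fmap. Qed.

Lemma isomorphic_retract X Y : isomorphic X Y -> retract_of X Y.
Proof. by move=> [f [g [gf _]]]; exists f, g. Qed.

Lemma retract_trans Y X Z :
  retract_of X Y -> retract_of Y Z -> retract_of X Z.
Proof.
move=> [i [p pi1]] [j [q qj1]]; exists (j \c i), (p \c q).
by rewrite compmA -(compmA p) qj1 compm1.
Qed.

Lemma retract_fmap (D : category) (F : functor C D) X Y :
  retract_of X Y -> retract_of (F X) (F Y).
Proof. by move=> [i [p e]]; exists (fmap F i), (fmap F p); rewrite -fmapM e fmap1. Qed.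

Lemma iso_monic X Y Z (f : mor Y Z) (a b : mor X Y) :
  is_iso f -> f \c a = f \c b -> a = b.
Proof. by move=> [g [gf _]] e; rewrite -(comp1m a) -(comp1m b) -gf -!compmA e. Qed.

Lemma iso_epic X Y Z (f : mor X Y) (a b : mor Y Z) :
  is_iso f -> a \c f = b \c f -> a = b.
Proof. by move=> [g [_ fg]] e; rewrite -(compm1 a) -(compm1 b) -fg !compmA e. Qed.

End Categories.

Section Equivalences.
Variables (C D : category) (F : functor C D).
Hypothesis eqF : is_equivalence F.

Lemma equivalence_faithful (X Y : C) (f g : mor X Y) :
  fmap F f = fmap F g -> f = g.
Proof.
have [G [[a [an ai]] _]] := eqF => e.
by apply: (iso_epic (ai X)); rewrite -[f]/(fmap (idF C) f) -[g]/(fmap (idF C) g)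
  -!an /= e.
Qed.

Lemma equivalence_full (X Y : C) (p : mor (F X) (F Y)) :
  exists f : mor X Y, fmap F f = p.
Proof.
have [G [[a [an ai]] [b [bn bi]]]] := eqF.
have [a' [a'a aa']] := ai X.
pose f : mor X Y := a Y \c fmap G p \c a'.
have GE : fmap G (fmap F f) = fmap G p.
  apply: (iso_monic (ai Y)).
  have := an X Y f; rewrite /= => ->.
  by rewrite /f -!compmA a'a compm1.
exists f; apply: (@iso_epic D _ _ _ (b (F X)) (fmap F f) p (bi _)).
by rewrite -[fmap F f]/(fmap (idF D) _) -[in RHS]/(fmap (idF D) p) -!bn /= GE.
Qed.

Lemma equivalence_surj (Y : D) : exists X : C, isomorphic Y (F X).
Proof.
have [G [_ [b [_ bi]]]] := eqF; exists (G Y); apply: isomorphic_sym.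
by exists (b Y); apply: bi.
Qed.

Lemma equivalence_reflects_isomorphic (X Y : C) :
  isomorphic (F X) (F Y) -> isomorphic X Y.
Proof.
move=> [p [q [qp pq]]].
have [f fE] := equivalence_full p; have [g gE] := equivalence_full q.
exists f, g; split; apply: equivalence_faithful.
  by rewrite fmapM fE gE fmap1.
by rewrite fmapM fE gE fmap1.
Qed.

Lemma equivalence_reflects_retract (X Y : C) :
  retract_of (F X) (F Y) -> retract_of X Y.
Proof.
move=> [p [q qp]].
have [f fE] := equivalence_full p; have [g gE] := equivalence_full q.
exists f, g; apply: equivalence_faithful.
by rewrite fmapM fE gE fmap1.
Qed.

End Equivalences.

(** * Additive categories and additive functors *)

Section Additive.
Variable A : additive_category.
Implicit Types X Y Z : A.

Lemma comp0m X Y Z (f : mor X Y) : (0 : mor Y Z) \c f = 0.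
Proof. by apply: (addrI ((0 : mor Y Z) \c f)); rewrite -compmDl !addr0. Qed.

Lemma compm0 X Y Z (g : mor Y Z) : g \c (0 : mor X Y) = 0.
Proof. by apply: (addrI (g \c (0 : mor X Y))); rewrite -compmDr !addr0. Qed.

Lemma compNm X Y Z (g : mor Y Z) (f : mor X Y) : (- g) \c f = - (g \c f).
Proof. by apply: (addrI (g \c f)); rewrite -compmDl !subrr comp0m. Qed.

Lemma compmN X Y Z (g : mor Y Z) (f : mor X Y) : g \c (- f) = - (g \c f).
Proof. by apply: (addrI (g \c f)); rewrite -compmDr !subrr compm0. Qed.

Lemma zero_idmor X : idmor X = 0 -> is_zero X.
Proof.
move=> e; split=> Y f; first by rewrite -(comp1m f) e comp0m.
by rewrite -(compm1 f) e compm0.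
Qed.

Lemma zero_isomorphic X Y : isomorphic X Y -> is_zero X -> is_zero Y.
Proof.
move=> [f [g [_ fg]]] [X0 _]; apply: zero_idmor.
by rewrite -fg (X0 _ g) compm0.
Qed.

Lemma is_iso_opp X Y (f : mor X Y) : is_iso f -> is_iso (- f).
Proof. by move=> [g [gf fg]]; exists (- g); rewrite !compNm !compmN !opprK. Qed.

End Additive.

Section AdditiveFunctors.
Variables (A B : additive_category) (F : functor A B).
Hypothesis addF : additive_functor F.

Lemma fmap0 (X Y : A) : fmap F (0 : mor X Y) = 0.
Proof. by apply: (addrI (fmap F (0 : mor X Y))); rewrite -addF !addr0. Qed.

Lemma zero_fmap (X : A) : is_zero X -> is_zero (F X).
Proof. by move=> [X0 _]; apply: zero_idmor; rewrite -fmap1 (X0 _ (idmor X)) fmap0. Qed.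

End AdditiveFunctors.

(** * Distinguished triangles and extensions *)

Section Triangles.
Variable C : triangulated_category.
Implicit Types X Y Z : C.

Let shiftE := shift_equivalence C.

Lemma zero_object : exists Z : C, is_zero Z.
Proof. exact: has_zero_object. Qed.

Lemma shift_zero Z : is_zero Z -> is_zero (shift Z).
Proof. exact: (zero_fmap (@shift_additive C)). Qed.

Lemma unshift_zero Z : is_zero (shift Z) -> is_zero Z.
Proof.
move=> [z _]; apply: zero_idmor; apply: (equivalence_faithful shiftE).
by rewrite (z _ (fmap _ _)) (fmap0 (@shift_additive C)).
Qed.

Lemma dist_comp0 X Y Z (f : mor X Y) (g : mor Y Z) (h : mor Z (shift X)) :
  dist f g h -> g \c f = 0.
Proof.
have [O O0] := zero_object => d.
have [|c [e _]] := dist_fill (dist_id X O0) d (a := idmor X) (b := f).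
  by rewrite !compm1.
by rewrite -e compm0.
Qed.

(** Compare with the rotation of the triangle [M = M -> O]. The third component of the filler lives
    on shifts and is desuspended by fullness of the shift. *)
Lemma dist_lift M X Y Z (f : mor X Y) (g : mor Y Z) (h : mor Z (shift X))
    (u : mor M Y) :
  dist f g h -> g \c u = 0 -> exists v : mor M X, u = f \c v.
Proof.
have [O O0] := zero_object => d gu0.
have /dist_rotate d1 := dist_id M O0; have /dist_rotate d2 := d.
have [|c [_ e]] := dist_fill d1 d2 (a := u) (b := 0).
  by rewrite gu0 compm0.
have [v vE] := equivalence_full shiftE c; exists v.
apply: (equivalence_faithful shiftE); apply: oppr_inj.
move: e; rewrite compmN fmap1 compm1 compNm => ->.
by rewrite fmapM vE.
Qed.

(** The shift is only essentially surjective, so rotating backwards gives as new first vertex a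
    desuspension of [Z] up to isomorphism. *)
Lemma unrotate X Y Z (f : mor X Y) (g : mor Y Z) (h : mor Z (shift X)) :
  dist f g h -> exists (Z' : C) (i : mor Z' X) (k : mor Y (shift Z')),
    dist i f k /\ isomorphic Z (shift Z').
Proof.
move=> d; have [Z' [p [q [qp pq]]]] := equivalence_surj shiftE Z.
have [i iE] := equivalence_full shiftE (- (h \c q)).
exists Z', i, (p \c g); split; last by exists p, q.
apply/dist_rotate; apply: dist_iso d _.
exists (idmor X), (idmor Y), p; split.
  by split; [exact: iso_idmor|exact: iso_idmor|exists q].
split; rewrite ?compm1 ?comp1m //.
by rewrite iE opprK fmap1 comp1m -compmA qp compm1.
Qed.

Lemma dist_colift M X Y Z (f : mor X Y) (g : mor Y Z) (h : mor Z (shift X))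
    (u : mor Y M) :
  dist f g h -> u \c f = 0 -> exists v : mor Z M, u = v \c g.
Proof.
have [O O0] := zero_object => d uf0.
have [O' [i [k [d1 OO']]]] := unrotate (dist_id M O0).
have O'0 : is_zero O'.
  by apply: unshift_zero; apply: zero_isomorphic OO' O0.
have [|c [e _]] := dist_fill d d1 (a := 0) (b := u).
  by rewrite uf0 compm0.
by exists c; rewrite e comp1m.
Qed.

Lemma dist_iso_zero X Y Z (f : mor X Y) (g : mor Y Z) (h : mor Z (shift X)) :
  dist f g h -> is_zero X -> is_iso g.
Proof.
move=> d X0; have [hz _] := shift_zero X0.
have /dist_rotate d' := d.
have [|v e] := dist_lift d' (u := idmor Z); first by rewrite (hz _ h) comp0m.
exists v; split=> //.
have [|x] := dist_lift d (u := v \c g - idmor Y).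
  by rewrite compmDr compmN compmA -e comp1m compm1 subrr.
by have [_ fz] := X0; rewrite (fz _ f) comp0m => /eqP; rewrite subr_eq0 => /eqP.
Qed.

(** Three rotations put a sign on all three morphisms; the automorphism [- idmor] of the middle
    vertex removes the first two. *)
Lemma dist_shift X Y Z (f : mor X Y) (g : mor Y Z) (h : mor Z (shift X)) :
  dist f g h <-> dist (fmap shift f) (fmap shift g) (- fmap shift h).
Proof.
have E : dist f g h <->
    dist (- fmap shift f) (- fmap shift g) (- fmap shift h).
  split; first by move/dist_rotate/dist_rotate/dist_rotate.
  by move=> d; do 3 apply/dist_rotate.
apply: (iff_trans E); split=> d; apply: dist_iso d _;
    exists (idmor _), (- idmor _), (idmor _); (split;
    [split; [exact: iso_idmor|apply: is_iso_opp; exact: iso_idmor|exact: iso_idmor]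
    |split; rewrite ?fmap1 ?compm1 ?comp1m ?compNm ?compmN ?compm1 ?comp1m ?opprK //]).
Qed.

Lemma dist_iso_objects X Y Z (f : mor X Y) (g : mor Y Z) (h : mor Z (shift X))
    X' Y' Z' : dist f g h ->
  isomorphic X X' -> isomorphic Y Y' -> isomorphic Z Z' ->
  exists (f' : mor X' Y') (g' : mor Y' Z') (h' : mor Z' (shift X')),
    dist f' g' h'.
Proof.
move=> d [a [a' [a'a aa']]] [b [b' [b'b bb']]] [c [c' [c'c cc']]].
exists (b \c f \c a'), (c \c g \c b'), (fmap shift a \c h \c c').
apply: dist_iso d _; exists a, b, c; split.
  by split; [exists a'|exists b'|exists c'].
by split; rewrite -!compmA ?a'a ?b'b ?c'c ?compm1.
Qed.

(** The product [P * Q] of classes of objects, whose associativity is a form of the octahedral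
    axiom. *)
Definition star (P Q : C -> Prop) : C -> Prop := fun X =>
  exists (A B : C) (f : mor A X) (g : mor X B) (h : mor B (shift A)),
    [/\ dist f g h, P A & Q B].

Definition iso_closed (P : C -> Prop) :=
  forall X Y, isomorphic X Y -> P X -> P Y.

Lemma star_mono (P Q P' Q' : C -> Prop) X :
  (forall A, P A -> P' A) -> (forall A, Q A -> Q' A) ->
  star P Q X -> star P' Q' X.
Proof.
by move=> PP QQ [A [B [f [g [h [d /PP a /QQ b]]]]]]; exists A, B, f, g, h.
Qed.

Lemma star_iso (P Q : C -> Prop) : iso_closed (star P Q).
Proof.
move=> X Y XY [A [B [f [g [h [d a b]]]]]].
have [f' [g' [h' d']]] := dist_iso_objects d (isomorphic_refl _) XY (isomorphic_refl _).
by exists A, B, f', g', h'.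
Qed.

Lemma star_shift (P Q : C -> Prop) X : iso_closed P -> iso_closed Q ->
  star P Q (shift X) <-> star (fun A => P (shift A)) (fun A => Q (shift A)) X.
Proof.
move=> Pi Qi; split=> [[A [B [f [g [h [d a b]]]]]]|].
  have [A' AA'] := equivalence_surj shiftE A.
  have [B' BB'] := equivalence_surj shiftE B.
  have [f' [g' [h' d']]] := dist_iso_objects d AA' (isomorphic_refl _) BB'.
  have [f1 f1E] := equivalence_full shiftE f'.
  have [g1 g1E] := equivalence_full shiftE g'.
  have [h1 h1E] := equivalence_full shiftE (- h').
  exists A', B', f1, g1, h1; split; [|exact: Pi AA' a|exact: Qi BB' b].
  by apply/dist_shift; rewrite f1E g1E h1E opprK.
move=> [A [B [f [g [h [/dist_shift d a b]]]]]].
by exists (shift A), (shift B), (fmap shift f), (fmap shift g), (- fmap shift h).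
Qed.

Lemma star_assocl (P Q R : C -> Prop) X :
  star (star P Q) R X -> star P (star Q R) X.
Proof.
move=> [A [B [f [g [h [d [P1 [Q1 [i [p [j [d1 HP HQ]]]]]] HR]]]]]].
have [Y [m [n d2]]] := dist_cone (f \c i).
have [u [v [d3 _ _ _ _]]] := dist_octahedron d1 d d2.
exists P1, Y, (f \c i), m, n; split=> //.
by exists Q1, B, u, v, (fmap shift p \c h).
Qed.

Lemma star_assocr (P Q R : C -> Prop) X :
  star P (star Q R) X -> star (star P Q) R X.
Proof.
move=> [P1 [Y [i [p [j [d1 HP [Q1 [R1 [f [g [h [d HQ HR]]]]]]]]]]]].
have /dist_rotate d1' := d1; have /dist_rotate d' := d.
have [F [m [n d2]]] := dist_cone (g \c p).
have [u [v [d3 _ _ _ _]]] := dist_octahedron d1' d' d2.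
have [F' [i' [k [d2' FF']]]] := unrotate d2.
exists F', R1, i', (g \c p), k; split=> //.
(* The octahedron involves [shift P1] and [shift Q1]. Passing to the classes of objects isomorphic
   to them lets [star_shift] desuspend the triangle. *)
have ic Z : iso_closed [eta isomorphic (shift Z)].
  by move=> ? ? h1 h2; apply: isomorphic_trans h2 h1.
have /(star_shift _ (ic P1) (ic Q1)) :
    star [eta isomorphic (shift P1)] [eta isomorphic (shift Q1)] (shift F').
  apply: star_iso FF' _; exists (shift P1), (shift Q1), u, v; eexists.
  by split; [exact: d3|exact: isomorphic_refl|exact: isomorphic_refl].
move=> [A [B [f' [g' [h' [d4 /(equivalence_reflects_isomorphic shiftE) PA
  /(equivalence_reflects_isomorphic shiftE) QB]]]]]].
have [f1 [g1 [h1 d5]]] := dist_iso_objects d4 (isomorphic_sym PA)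
  (isomorphic_refl _) (isomorphic_sym QB).
by exists P1, Q1, f1, g1, h1.
Qed.

(* The connecting morphism vanishes, so the extension splits and its two
   pieces can be exchanged. *)
Lemma star_swap (P Q : C -> Prop) X : iso_closed P ->
  (forall A B, Q A -> P B -> forall f : mor A (shift B), f = 0) ->
  star P Q X -> star Q P X.
Proof.
move=> Pi QP [A [B [f [g [h [d a b]]]]]].
have /dist_rotate d' := d.
have [|s sE] := dist_lift d' (u := idmor B); first by rewrite (QP B A b a h) comp0m.
have [Z [p [q ds]]] := dist_cone s.
have [O O0] := zero_object.
have dB := dist_id B O0; rewrite sE in dB.
have [u [v [d3 _ _ _ _]]] := dist_octahedron ds d' dB.
have /dist_rotate d4 := d3.
have AZ : isomorphic (shift A) (shift Z) by eexists; apply: dist_iso_zero d4 O0.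
exists B, Z, s, p, q; split=> //.
exact: Pi (equivalence_reflects_isomorphic shiftE AZ) a.
Qed.

End Triangles.

(** * Morphisms with cone in a triangulated subcategory *)

Definition left_cancellable (C : category) (W : morphism_class C) : Prop :=
  forall (X Y Z : C) (t : mor X Y) (f g : mor Y Z), W X Y t -> f \c t = g \c t ->
  exists (T : C) (s : mor Z T), W Z T s /\ s \c f = s \c g.

Lemma strongly_generated_triangulated (C : triangulated_category)
  (G : C -> Prop) : triangulated_subcategory (strongly_generated G).
Proof.
split.
- by move=> X Y XY GX D HD GD; exact: (tsub_iso HD XY (GX D HD GD)).
- by move=> Z Z0 D HD GD; apply: (tsub_zero HD).
- move=> X; split=> GX D HD GD; first exact: ((tsub_shift HD X).1 (GX D HD GD)).
  apply/(tsub_shift HD); exact: (GX D HD GD).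
- move=> X Y Z f g h d GX GY D HD GD.
  exact: (tsub_cone HD d (GX D HD GD) (GY D HD GD)).
Qed.

Section ConesInSubcategory.
Variables (C : triangulated_category) (D : C -> Prop).
Hypothesis HD : triangulated_subcategory D.
Implicit Types X Y Z : C.
Notation W := (cone_in D).

Lemma tsub_ext X Y Z (f : mor X Y) (g : mor Y Z) (h : mor Z (shift X)) :
  dist f g h -> D X -> D Z -> D Y.
Proof.
move=> /dist_rotate/dist_rotate d DX DZ; apply/(tsub_shift HD).
exact: (tsub_cone HD d DZ ((tsub_shift HD X).1 DX)).
Qed.

Lemma tsub_fiber X Y Z (f : mor X Y) (g : mor Y Z) (h : mor Z (shift X)) :
  dist f g h -> D Y -> D Z -> D X.
Proof.
by move=> /dist_rotate d DY DZ; apply/(tsub_shift HD); exact: (tsub_cone HD d DY DZ).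
Qed.

Lemma cone_in_id X : W (idmor X).
Proof.
have [O O0] := zero_object C; exists O, 0, 0; split; first exact: dist_id.
exact: (tsub_zero HD).
Qed.

Lemma cone_in_comp X Y Z (g : mor Y Z) (f : mor X Y) : W g -> W f -> W (g \c f).
Proof.
move=> [A [k [j [dg DA]]]] [B [h [l [df DB]]]].
have [E [m [n d]]] := dist_cone (g \c f).
have [u [v [d1 _ _ _ _]]] := dist_octahedron df dg d.
by exists E, m, n; split=> //; apply: tsub_ext d1 DB DA.
Qed.

Lemma cone_in_compK X Y Z (g : mor Y Z) (f : mor X Y) :
  W g -> W (g \c f) -> W f.
Proof.
move=> [A [k [j [dg DA]]]] [E [m [n [d DE]]]].
have [B [h [l df]]] := dist_cone f.
have [u [v [d1 _ _ _ _]]] := dist_octahedron df dg d.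
by exists B, h, l; split=> //; apply: tsub_fiber d1 DE DA.
Qed.

Lemma cone_in_fiber X Y (f : mor X Y) : W f ->
  exists (T : C) (i : mor T X) (k : mor Y (shift T)), dist i f k /\ D T.
Proof.
move=> [Z [g [h [d DZ]]]]; have [T [i [k [d1 ZT]]]] := unrotate d.
by exists T, i, k; split=> //; apply/(tsub_shift HD); exact: (tsub_iso HD ZT DZ).
Qed.

(** A homotopy pushout: the fibre [T] of [g] is also a fibre of [s], since [s] is the map to the
    cone of [u \c i]. *)
Lemma cone_in_ore : left_ore W.
Proof.
move=> X Y Z g u Wg; have [T [i [k [d DT]]]] := cone_in_fiber Wg.
have [M [s [j d1]]] := dist_cone (u \c i).
have [|f [e _]] := dist_fill d d1 (a := idmor T) (b := u); first by rewrite compm1.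
exists M, f, s; split=> //; have /dist_rotate d2 := d1.
by eexists; eexists; eexists; split; [exact: d2|apply: (tsub_shift HD _).1].
Qed.

(** [f] factors through the cone [A] of [t]. The map [s] to the cone of the factor [A -> Z] kills
    [f], and its own cone is [shift A]. *)
Lemma cone_in_kill X Y Z (t : mor X Y) (f : mor Y Z) :
  W t -> f \c t = 0 -> exists (T : C) (s : mor Z T), W s /\ s \c f = 0.
Proof.
move=> [A [p [q [d DA]]]] ft0; have [f' ->] := dist_colift d ft0.
have [B [s [j d1]]] := dist_cone f'; exists B, s.
split; last by rewrite compmA (dist_comp0 d1) comp0m.
have /dist_rotate d2 := d1.
by eexists; eexists; eexists; split; [exact: d2|apply: (tsub_shift HD _).1].
Qed.

Lemma cone_in_left_cancellable : left_cancellable W.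
Proof.
move=> X Y Z t f g Wt e.
have [|T [s [Ws sE]]] := cone_in_kill Wt (f := f - g).
  by rewrite compmDl compNm e subrr.
exists T, s; split=> //; apply/eqP; rewrite -subr_eq0 -compmN -compmDr.
exact/eqP.
Qed.

Lemma factor_through X Y Z (f : mor X Y) (s : mor Y Z) :
  W s -> s \c f = 0 ->
  exists (T : C) (a : mor X T) (b : mor T Y), D T /\ f = b \c a.
Proof.
move=> Ws sf0; have [T [i [k [d DT]]]] := cone_in_fiber Ws.
by have [a ->] := dist_lift d sf0; exists T, a, i.
Qed.

End ConesInSubcategory.

(** * Left fractions *)

Section LeftFractions.
Variables (C : category) (W : morphism_class C).
Arguments W {X Y} _.
Hypothesis W_id : forall X : C, W (idmor X).
Hypothesis W_comp : forall (X Y Z : C) (g : mor Y Z) (f : mor X Y),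
  W g -> W f -> W (g \c f).
Hypothesis W_ore : left_ore (@W).
Hypothesis W_cancel : left_cancellable (@W).

Section Fractions.
Variable M : C.

Record fraction (X : C) := Fraction {
  fr_apex : C;
  fr_num : mor M fr_apex;
  fr_den : mor X fr_apex;
  fr_inv : W fr_den }.

(* [fr_rel u p q] says that [u \o p = q] as morphisms from [M] to [Y] in the
   localization. *)
Definition fr_rel (X Y : C) (u : mor X Y) (p : fraction X) (q : fraction Y) :=
  exists (U : C) (k : mor (fr_apex p) U) (l : mor (fr_apex q) U),
  [/\ W (l \c fr_den q), k \c fr_den p = l \c fr_den q \c u
    & k \c fr_num p = l \c fr_num q].

Lemma fr_rel_refl X (p : fraction X) : fr_rel (idmor X) p p.
Proof.
exists (fr_apex p), (idmor _), (idmor _).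
by rewrite !comp1m compm1; split=> //; apply: fr_inv.
Qed.

Lemma fr_rel_sym X (p q : fraction X) :
  fr_rel (idmor X) p q -> fr_rel (idmor X) q p.
Proof.
move=> [U [k [l]]]; rewrite compm1 => -[w e1 e2].
by exists U, l, k; rewrite compm1 e1.
Qed.

Lemma fr_rel_comp X Y Z (v : mor Y Z) (u : mor X Y) p q r :
  fr_rel u p q -> fr_rel v q r -> fr_rel (v \c u) p r.
Proof.
move=> [U [k [l [wl e1 e2]]]] [V [k' [l' [wl' e1' e2']]]].
have [N [n [m [wm e]]]] := W_ore (k' \c fr_den q) wl.
have [|N' [t [wt te]]] := W_cancel (f := n \c l) (g := m \c k') (fr_inv q).
  by rewrite -!compmA.
exists N', (t \c n \c k), (t \c m \c l'); split.
- by rewrite -!compmA; apply: W_comp => //; apply: W_comp.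
- rewrite -(compmA _ k) e1 !compmA -(compmA t n l) te.
  by rewrite -!compmA (compmA k') e1' !compmA.
- by rewrite -(compmA _ k) e2 compmA -(compmA t n l) te -!compmA e2'.
Qed.

Lemma fr_rel_push X Y (u : mor X Y) p : exists q, fr_rel u p q.
Proof.
have [T [v [s [ws e]]]] := W_ore u (fr_inv p).
exists (@Fraction Y T (v \c fr_num p) s ws), T, v, (idmor T).
by rewrite /= !comp1m.
Qed.

(** For [v] the identity this is uniqueness of the composite of [u] and [p]; the general form gives
    functoriality of direct images. *)
Lemma fr_rel_pushK X Y Z (v : mor Y Z) (u : mor X Y) p q r :
  fr_rel u p q -> fr_rel (v \c u) p r -> fr_rel v q r.
Proof.
move=> [U [k [l [wl e1 e2]]]] [V [k' [l' [wl' e1' e2']]]].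
have [N [n [m [wm e]]]] := W_ore (l' \c fr_den r \c v) wl.
have [|N' [t [wt te]]] := W_cancel (f := n \c k) (g := m \c k') (fr_inv p).
  by rewrite -!compmA e1 e1' !compmA -(compmA n) e !compmA.
exists N', (t \c n \c l), (t \c m \c l'); split.
- by rewrite -!compmA; apply: W_comp => //; apply: W_comp.
- by rewrite -!compmA e !compmA.
- by rewrite -!compmA -e2 -e2' !compmA -(compmA t n k) te !compmA.
Qed.

(** The fraction [u^-1 \o q] keeps the numerator of [q] and has the denominator [fr_den q \c u]. *)
Lemma fr_rel_pull X Y (u : mor X Y) (wu : W u) (q : fraction Y) :
  exists p, forall r, fr_rel u p r <-> fr_rel (idmor Y) q r.
Proof.
have wp : W (fr_den q \c u) by apply: W_comp => //; apply: fr_inv.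
exists (@Fraction X _ (fr_num q) (fr_den q \c u) wp).
move=> r; split=> -[U [k [l /= [wl e1 e2]]]].
  have [|N' [t [wt te]]] := W_cancel (f := k \c fr_den q) (g := l \c fr_den r) wu.
    by rewrite -!compmA in e1 *.
  exists N', (t \c k), (t \c l); rewrite compm1 -!compmA te e2; split=> //.
  exact: W_comp.
by exists U, k, l => /=; rewrite compmA e1 compm1.
Qed.

End Fractions.

(* Subsets of the set of morphisms from [M] to [X] in the localization, encoded
   as saturated sets of fractions so that no quotient type is needed. *)
Definition fr_set (M X : C) : Type :=
  {P : fraction M X -> Prop | forall p q, P p -> fr_rel (idmor X) p q -> P q}.

Lemma fr_set_eq M X (P Q : fr_set M X) :
  (forall p, sval P p <-> sval Q p) -> P = Q.
Proof.
case: P Q => [P hP] [Q hQ] /= e.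
have E : P = Q.
  by apply: functional_extensionality => p; apply: propositional_extensionality.
by subst Q; congr exist; apply: proof_irrelevance.
Qed.

Lemma fr_image_subproof M X Y (u : mor X Y) (P : fr_set M X) p q :
  (exists2 r, sval P r & fr_rel u r p) -> fr_rel (idmor Y) p q ->
  exists2 r, sval P r & fr_rel u r q.
Proof.
move=> [r Pr rp] pq; exists r => //.
by rewrite -(comp1m u); apply: fr_rel_comp rp pq.
Qed.

Definition fr_image M X Y (u : mor X Y) (P : fr_set M X) : fr_set M Y :=
  exist _ _ (@fr_image_subproof M X Y u P).

Lemma fr_image_comp M X Y Z (v : mor Y Z) (u : mor X Y) (P : fr_set M X) :
  fr_image (v \c u) P = fr_image v (fr_image u P).
Proof.
apply: fr_set_eq => r /=; split=> [[p Pp pr]|[q [p Pp pq] qr]].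
  have [q pq] := fr_rel_push u p.
  by exists q; [exists p|apply: fr_rel_pushK pq pr].
by exists p => //; apply: fr_rel_comp pq qr.
Qed.

Lemma fr_image_id M X (P : fr_set M X) : fr_image (idmor X) P = P.
Proof.
apply: fr_set_eq => p /=; split=> [[q Pq]|Pp]; first by apply: (svalP P).
by exists p => //; apply: fr_rel_refl.
Qed.

(* The objects are those of [C], not the types [fr_set M X]: the universal
   property of a localization only ranges over categories in the universes of
   [C]. *)
Definition fr_category : category :=
  @Category C (fun X Y => forall M, fr_set M X -> fr_set M Y)
    (fun X M P => P) (fun X Y Z g f M P => g M (f M P))
    (fun _ _ _ => erefl) (fun _ _ _ => erefl) (fun _ _ _ _ _ _ _ => erefl).

Lemma fr_functor_id X :
  (fun M (P : fr_set M X) => fr_image (idmor X) P) =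
  idmor (X : fr_category).
Proof.
apply: functional_extensionality_dep => M.
by apply: functional_extensionality => P; apply: fr_image_id.
Qed.

Lemma fr_functor_comp X Y Z (v : mor Y Z) (u : mor X Y) :
  (fun M (P : fr_set M X) => fr_image (v \c u) P) =
  compm (c := fr_category) (fun M P => fr_image v P) (fun M P => fr_image u P).
Proof.
apply: functional_extensionality_dep => M.
by apply: functional_extensionality => P; apply: fr_image_comp.
Qed.

Definition fr_functor : functor C fr_category :=
  @Functor C fr_category id (fun X Y u M P => fr_image u P)
    fr_functor_id fr_functor_comp.

Lemma fr_preimage_subproof M X Y (u : mor X Y) (P : fr_set M Y) p q :
  (exists2 r, sval P r & fr_rel u p r) -> fr_rel (idmor X) p q ->
  exists2 r, sval P r & fr_rel u q r.
Proof.
move=> [r Pr rp] pq; exists r => //.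
by rewrite -(compm1 u); apply: fr_rel_comp (fr_rel_sym pq) rp.
Qed.

Definition fr_preimage M X Y (u : mor X Y) (P : fr_set M Y) : fr_set M X :=
  exist _ _ (@fr_preimage_subproof M X Y u P).

Lemma fr_rel_inj M X Y (u : mor X Y) (p q : fraction M X) r : W u ->
  fr_rel u p r -> fr_rel u q r -> fr_rel (idmor X) p q.
Proof.
move=> wu [U [k [l [wl e1 e2]]]] [V [k' [l' [wl' e1' e2']]]].
have [N [n [m [wm e]]]] := W_ore (l' \c fr_den r) wl.
have [|N' [t [wt te]]] := W_cancel (f := n \c l) (g := m \c l') (fr_inv r).
  by rewrite -!compmA.
exists N', (t \c n \c k), (t \c m \c k'); split.
- rewrite -!compmA e1'; apply: W_comp => //; apply: W_comp => //.
  exact: W_comp.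
- rewrite compm1 -!compmA e1 e1' !compmA -(compmA t n l) te.
  by rewrite !compmA.
- by rewrite -!compmA e2 e2' !compmA -(compmA t n l) te !compmA.
Qed.

(** The inverse of the direct image is the preimage: composition with [u] is injective on classes of
    fractions by [fr_rel_inj] and surjective by [fr_rel_pull]. *)
Lemma fr_functor_inverts : inverts (@W) fr_functor.
Proof.
move=> X Y u wu.
exists (fun M P => fr_preimage u P); split;
    apply: functional_extensionality_dep => M;
    apply: functional_extensionality => P; apply: fr_set_eq => p /=.
  split=> [[r [q Pq qr] pr]|Pp].
    by apply: (svalP P _ _ Pq); apply: fr_rel_inj qr pr.
  by have [q pq] := fr_rel_push u p; exists q => //; exists p.
split=> [[q [r Pr qr] qp]|Pp].
  by apply: (svalP P _ _ Pr); apply: fr_rel_pushK qr _; rewrite comp1m.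
have [q qE] := fr_rel_pull wu p.
by exists q; [exists p => //|]; apply/qE; apply: fr_rel_refl.
Qed.

(** A Yoneda argument: the image under [g] of the class of the identity fraction contains the
    fraction with numerator [f] and identity denominator. Unfolding this yields [s]. *)
Lemma fr_functor_faithful X Y (f g : mor X Y) :
  fmap fr_functor f = fmap fr_functor g ->
  exists (T : C) (s : mor Y T), W s /\ s \c f = s \c g.
Proof.
move=> e.
pose p : fraction X X := Fraction (idmor X) (W_id X).
have sat q r : fr_rel (idmor X) p q -> fr_rel (idmor X) q r ->
    fr_rel (idmor X) p r.
  by move=> pq qr; rewrite -(comp1m (idmor X)); apply: fr_rel_comp pq qr.
pose P : fr_set X X := exist _ _ sat.
pose q : fraction X Y := Fraction f (W_id Y).
have : sval (fr_image g P) q.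
  have <- : fr_image f P = fr_image g P.
    by have := congr1 (fun F : mor (fr_functor X) (fr_functor Y) => F X P) e.
  exists p; first exact: fr_rel_refl.
  by exists Y, f, (idmor Y); rewrite /= !comp1m compm1.
move=> [p' [U [k [l /= [w1 e1 e2]]]] [V [k' [l' /= [w2 e3 e4]]]]].
rewrite !compm1 in e1 e2 w2 e3 e4.
have [N [n [m [wm em]]]] := W_ore (k' \c fr_den p') w1.
have [|N' [t [wt te]]] := W_cancel (f := n \c l) (g := m \c k') (fr_inv p').
  by rewrite -!compmA.
exists N', (t \c m \c l'); split; first by rewrite -compmA; do 2 apply: W_comp => //.
rewrite -!compmA -e4 -e3 !compmA -(compmA t m k') -te.
by rewrite -!compmA -e2 e1.
Qed.

End LeftFractions.

(** * Morphisms of a localization as left fractions *)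

Section Localization.
Variables (C C' : category) (W : morphism_class C) (L : functor C C').
Arguments W {X Y} _.
Hypothesis W_id : forall X : C, W (idmor X).
Hypothesis W_comp : forall (X Y Z : C) (g : mor Y Z) (f : mor X Y),
  W g -> W f -> W (g \c f).
Hypothesis W_ore : left_ore (@W).
Hypothesis W_cancel : left_cancellable (@W).
Hypothesis loc : is_localization (@W) L.

Lemma loc_inverts (X Y : C) (s : mor X Y) : W s -> is_iso (fmap L s).
Proof. by have [h _ _] := loc; apply: h. Qed.

(** Since [fr_functor] inverts [W], it factors through [L] up to isomorphism, so it cannot separate
    morphisms that [L] identifies. *)
Lemma loc_eq (X Y : C) (f g : mor X Y) : fmap L f = fmap L g ->
  exists (T : C) (s : mor Y T), W s /\ s \c f = s \c g.
Proof.
move=> e; have [_ univ _] := loc.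
have [G [a [an ai]]] := univ _ _ (fr_functor_inverts W_comp W_ore W_cancel).
apply: (fr_functor_faithful W_id (W_comp := W_comp) (W_ore := W_ore) (W_cancel := W_cancel)).
apply: (iso_epic (ai X)); rewrite -!an.
by rewrite /= e.
Qed.

Definition has_roof (X Y : C) (p : mor (L X) (L Y)) : Prop :=
  exists (T : C) (f : mor X T) (s : mor Y T), W s /\ fmap L s \c p = fmap L f.

Lemma has_roof_fmap X Y (f : mor X Y) : has_roof (fmap L f).
Proof. by exists Y, f, (idmor Y); rewrite -fmapM comp1m. Qed.

Lemma has_roof_id (X : C) : has_roof (idmor (L X)).
Proof. by rewrite -fmap1; apply: has_roof_fmap. Qed.

Lemma has_roof_comp (X Y Z : C) (q : mor (L Y) (L Z)) (p : mor (L X) (L Y)) :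
  has_roof q -> has_roof p -> has_roof (q \c p).
Proof.
move=> [U [g [t [wt et]]]] [T [f [s [ws es]]]].
have [V [h [r [wr er]]]] := W_ore g ws.
exists V, (h \c f), (r \c t); split; first exact: W_comp.
rewrite !fmapM -es -!compmA (compmA (fmap L t)) et !compmA -!fmapM er.
by rewrite fmapM.
Qed.

Definition roof_category : category.
Proof.
refine (@Category C (fun X Y => {p : mor (L X) (L Y) | has_roof p})
  (fun X => exist _ _ (has_roof_id X))
  (fun X Y Z g f => exist _ _ (has_roof_comp (svalP g) (svalP f))) _ _ _).
- move=> X Y [f hf]; apply: eq_sig_hprop => /=; last exact: compm1.
  by move=> *; apply: proof_irrelevance.
- move=> X Y [f hf]; apply: eq_sig_hprop => /=; last exact: comp1m.
  by move=> *; apply: proof_irrelevance.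
- move=> X Y Z U [h hh] [g hg] [f hf]; apply: eq_sig_hprop => /=; last exact: compmA.
  by move=> *; apply: proof_irrelevance.
Defined.

Lemma roof_eq X Y (p q : mor (X : roof_category) Y) : sval p = sval q -> p = q.
Proof. by apply: eq_sig_hprop => x; apply: proof_irrelevance. Qed.

Definition roof_functor : functor C roof_category.
Proof.
refine (@Functor C roof_category id (fun X Y f => exist _ _ (has_roof_fmap f)) _ _).
- by move=> X; apply: roof_eq; apply: fmap1.
- by move=> *; apply: roof_eq; apply: fmapM.
Defined.

Definition roof_inclusion : functor roof_category C' :=
  @Functor roof_category C' L (fun X Y p => sval p) (fun=> erefl)
    (fun _ _ _ _ _ => erefl).

Lemma roof_functor_inverts : inverts (@W) roof_functor.
Proof.
move=> X Y s ws; have [p [ps sp]] := loc_inverts ws.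
have hp : has_roof p by exists Y, (idmor Y), s; rewrite fmap1.
by exists (exist _ _ hp); split; apply: roof_eq.
Qed.

(** The roofs form a category in which [W] is already inverted, so the universal property gives a
    functor [G] from [C'] to it. Followed by the inclusion, [G] is isomorphic to the identity; hence
    every object comes from [C], and every morphism is a roof up to isomorphisms that are roofs. *)
Lemma loc_roof_surj :
  (forall X' : C', exists X : C, isomorphic X' (L X)) /\
  (forall (X Y : C) (p : mor (L X) (L Y)), has_roof p).
Proof.
have [_ univ nat] := loc.
have [G [a [an ai]]] := univ _ _ roof_functor_inverts.
pose K := compF roof_inclusion G.
have nK : natural (compF K L) (compF (idF C') L) (fun X => sval (a X)).
  by move=> X Y f; have := congr1 sval (an X Y f).
have [b [bn bE _]] := nat _ K (idF C') _ nK.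
pose c X : mor (X : roof_category) (G (L X)) :=
  sval (constructive_indefinite_description _ (ai X)).
have [ca ac] : (forall X, c X \c a X = idmor _) /\ (forall X, a X \c c X = idmor _).
  by split=> X; rewrite /c; case: constructive_indefinite_description => ? [].
have sca X : sval (c X) \c sval (a X) = idmor _ by exact: (congr1 sval (ca X)).
have sac X : sval (a X) \c sval (c X) = idmor _ by exact: (congr1 sval (ac X)).
split; last first.
  move=> X Y p; have := bn _ _ p; rewrite /= !bE => e.
  have -> : p = sval (a Y \c fmap G p \c c X).
    by rewrite /= e -compmA sac compm1.
  exact: svalP.
have nK' : natural (compF (idF C') L) (compF K L) (fun X => sval (c X)).
  move=> X Y f; have := nK X Y f; rewrite /= => e.
  transitivity (sval (c Y) \c (fmap L f \c sval (a X)) \c sval (c X)).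
    by rewrite -!compmA sac compm1.
  by rewrite -e compmA sca comp1m.
have [d [dn dE _]] := nat _ (idF C') K _ nK'.
move=> X'; exists (G X'), (d X'), (b X'); split.
  (* The composites of [b] and [d] restrict to identities along [L], so they are identities by the
     uniqueness clause. *)
  have [i [_ _ iU]] := nat _ (idF C') (idF C') (fun X => idmor (L X))
    (fun X Y f => etrans (comp1m _) (esym (compm1 _))).
  rewrite (iU (fun X => b X \c d X)) ?(iU (fun X => idmor X)) //.
  - by move=> X Y f; rewrite comp1m compm1.
  - by move=> X Y f; rewrite -compmA dn !compmA bn.
  - by move=> X; rewrite bE dE sac.
have [i [_ _ iU]] := nat _ K K (fun X => idmor _)
    (fun X Y f => etrans (comp1m _) (esym (compm1 _))).
rewrite (iU (fun X => d X \c b X)) ?(iU (fun X => idmor (K X))) //.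
- by move=> X Y f; rewrite comp1m compm1.
- by move=> X Y f; rewrite -compmA bn !compmA dn.
- by move=> X; rewrite bE dE sca.
Qed.

End Localization.

(** * Weight structures *)

Section Weights.
Variables (C : triangulated_category) (w : weight_structure C).
Implicit Types X Y Z : C.
Notation le0 := (w_le0 w).
Notation ge0 := (w_ge0 w).
Let shiftE := shift_equivalence C.

Lemma le0_iso : iso_closed le0.
Proof.
move=> X Y /isomorphic_sym /isomorphic_retract XY; exact: (w_le0_retract XY).
Qed.

Lemma ge0_iso : iso_closed ge0.
Proof.
move=> X Y /isomorphic_sym /isomorphic_retract XY; exact: (w_ge0_retract XY).
Qed.

Lemma ge0_shift X : ge0 X -> ge0 (shift X).
Proof.
move=> gX; apply: w_ge0_shift; exists X; split=> //; exact: isomorphic_refl.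
Qed.

Lemma le0_unshift X : le0 (shift X) -> le0 X.
Proof.
move=> /w_le0_shift [Y [lY XY]]; apply: le0_iso lY; apply: isomorphic_sym.
exact: equivalence_reflects_isomorphic XY.
Qed.

Lemma weight_orth X Y (f : mor X (shift Y)) : le0 X -> ge0 Y -> f = 0.
Proof.
move=> lX gY; apply: (w_orthogonal lX).
by exists Y; split=> //; apply: isomorphic_refl.
Qed.

Lemma weight_orth_unshift X Y (f : mor X Y) : le0 (shift X) -> ge0 Y -> f = 0.
Proof.
move=> lX gY; apply: (equivalence_faithful shiftE).
by rewrite (fmap0 (@shift_additive C)); apply: weight_orth.
Qed.

(** A weight decomposition of [shift U], rotated back so that [U] becomes the first vertex. *)
Lemma weight_dec U : exists (Y A : C) (f : mor U Y) (g : mor Y A)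
  (h : mor A (shift U)), [/\ dist f g h, ge0 Y & le0 A].
Proof.
have [A [B [h [q [k [d lA [Y [gY BY]]]]]]]] := w_decomposition w (shift U).
have [h' [f' [g' d']]] :=
  dist_iso_objects d (isomorphic_refl _) (isomorphic_refl _) BY.
have [f fE] := equivalence_full shiftE f'.
have [g gE] := equivalence_full shiftE g'.
exists Y, A, f, g, h'; split=> //; do 2 apply/dist_rotate.
apply: dist_iso d' _; exists (idmor _), (idmor _), (- idmor _); split.
  by split; [exact: iso_idmor|exact: iso_idmor|apply: is_iso_opp; exact: iso_idmor].
by rewrite fE gE !compNm !compmN fmap1 !comp1m !compm1 opprK.
Qed.

(** The map from [X] to the positive part of its weight decomposition vanishes, so [X] is a retract
    of the other part. *)
Lemma le0_char X :
  (forall Y (f : mor X (shift Y)), ge0 Y -> f = 0) -> le0 X.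
Proof.
move=> orth; have [A [B [f [g [h [d lA [Y [gY BY]]]]]]]] := w_decomposition w X.
have g0 : g = 0.
  have [b bi] := BY; apply: (iso_monic bi).
  by rewrite compm0; apply: orth.
have [|v vE] := dist_lift d (u := idmor X); first by rewrite g0 comp0m.
by apply: (w_le0_retract _ lA); exists v, f.
Qed.

Lemma ge0_char X :
  (forall M (f : mor M X), le0 (shift M) -> f = 0) -> ge0 X.
Proof.
move=> orth; have [Y [A [f [g [h [d gY lA]]]]]] := weight_dec X.
have [M [p [q [qp pq]]]] := equivalence_surj shiftE A.
have h0 : h = 0.
  have [m mE] := equivalence_full shiftE (h \c q).
  rewrite -(compm1 h) -qp compmA -mE (orth M m) ?(fmap0 (@shift_additive C)) ?comp0m //.
  by apply: le0_iso lA; exists p, q.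
have /dist_rotate/dist_rotate d' := d.
have [|v vE] := dist_colift d' (u := idmor _); first by rewrite comp1m.
apply: (w_ge0_retract _ gY); apply: (equivalence_reflects_retract shiftE).
by exists (- fmap shift f), v.
Qed.

Lemma le0_star X : star le0 le0 X -> le0 X.
Proof.
move=> [A [B [f [g [h [d lA lB]]]]]]; apply: le0_char => Y u gY.
have [|v ->] := dist_colift d (u := u); first exact: weight_orth.
by rewrite (weight_orth v lB gY) comp0m.
Qed.

Lemma ge0_star X : star ge0 ge0 X -> ge0 X.
Proof.
move=> [A [B [f [g [h [d gA gB]]]]]]; apply: ge0_char => M u lM.
have [|v ->] := dist_lift d (u := u); first exact: weight_orth_unshift.
by rewrite (weight_orth_unshift v lM gA) compm0.
Qed.

End Weights.

(** * Iterated shifts *)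

Section IteratedShift.
Variable C : triangulated_category.
Implicit Types X Y Z : C.
Let shiftE := shift_equivalence C.

Lemma star_iter_shift n (P Q : C -> Prop) X : iso_closed P -> iso_closed Q ->
  star P Q (iter n shift X) <->
  star (fun A => P (iter n shift A)) (fun A => Q (iter n shift A)) X.
Proof.
elim: n P Q => [|n IHn] P Q Pi Qi //=.
apply: (iff_trans (star_shift _ Pi Qi)).
by apply: IHn => A B /(isomorphic_fmap shift); [exact: Pi|exact: Qi].
Qed.

Lemma iter_shift_isomorphic n X Y :
  isomorphic (iter n shift X) (iter n shift Y) -> isomorphic X Y.
Proof.
by elim: n => //= n IHn /(equivalence_reflects_isomorphic shiftE).
Qed.

Lemma iter_shift_fmap_isomorphic n X Y :
  isomorphic X Y -> isomorphic (iter n shift X) (iter n shift Y).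
Proof. by move=> XY; elim: n => //= n /(isomorphic_fmap shift). Qed.

Lemma iter_shift_zero n X : is_zero (iter n shift X) <-> is_zero X.
Proof.
elim: n => //= n IHn; apply: iff_trans IHn.
by split; [apply: unshift_zero|apply: shift_zero].
Qed.

Lemma iter_tsub n (D : C -> Prop) X : triangulated_subcategory D ->
  D (iter n shift X) <-> D X.
Proof.
move=> HD; elim: n => //= n IHn; apply: iff_trans IHn.
by apply: iff_sym; apply: tsub_shift HD _.
Qed.

Lemma star_zero_right (P Q : C -> Prop) X :
  (forall Z, is_zero Z -> Q Z) -> P X -> star P Q X.
Proof.
have [O O0] := zero_object C => Q0 PX.
by exists X, O, (idmor X), 0, 0; split; [exact: dist_id|by []|exact: Q0].
Qed.

Lemma star_zero_left (P Q : C -> Prop) X :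
  (forall Z, is_zero Z -> P Z) -> Q X -> star P Q X.
Proof.
have [O O0] := zero_object C => P0 QX.
have [Z [i [k [d OZ]]]] := unrotate (dist_id X O0).
exists Z, X, i, (idmor X), k; split=> //; apply: P0.
by apply: unshift_zero; apply: zero_isomorphic OZ O0.
Qed.

End IteratedShift.

(** * The subcategory generated by cones of morphisms of the heart *)

Section GeneratedByHeartCones.
Variables (C : triangulated_category) (w : weight_structure C).
Variable S : morphism_class (heart w).
Implicit Types X Y Z : C.
Notation le0 := (w_le0 w).
Notation ge0 := (w_ge0 w).
Notation D := (strongly_generated (cones S)).
Let HD : triangulated_subcategory D := strongly_generated_triangulated (cones S).
Let shiftE := shift_equivalence C.

Lemma le0_zero Z : is_zero Z -> le0 Z.
Proof. by move=> [_ z]; apply: le0_char => Y f _; apply: z. Qed.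

Lemma ge0_zero Z : is_zero Z -> ge0 Z.
Proof. by move=> [z _]; apply: ge0_char => Y f _; apply: z. Qed.

Lemma ge0_iter_shift n X : ge0 X -> ge0 (iter n shift X).
Proof. by move=> gX; elim: n => //= n; apply: ge0_shift. Qed.

Lemma le0_iter_unshift n X : le0 (iter n shift X) -> le0 X.
Proof. by elim: n => //= n IHn /le0_unshift. Qed.

Lemma cones_ge0 Z : cones S Z -> ge0 Z.
Proof.
move=> [[X [gX lX]] [[Y [gY lY]] [s [_ [g [h /= /dist_rotate d]]]]]].
apply: ge0_star; exists Y, (shift X), g, h; eexists.
by split; [exact: d|exact: gY|exact: ge0_shift].
Qed.

(** Weight at most 1 is expressed on a desuspension [Z'] of [Z]. Shifted once, a test morphism
    vanishes on [Y], so it factors through [shift X], where it vanishes as well. *)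
Lemma cones_le1 Z Z' : cones S Z -> isomorphic (shift Z') Z -> le0 Z'.
Proof.
move=> [[X [gX lX]] [[Y [gY lY]] [s [_ [g [h /= /dist_rotate d]]]]]].
move=> [i [j [ji ij]]]; apply: le0_char => V f gV.
apply: (equivalence_faithful shiftE); rewrite (fmap0 (@shift_additive C)).
have [|v vE] := dist_colift d (u := fmap shift f \c j).
  by apply: (weight_orth _ lY); apply: ge0_shift.
have [v' v'E] := equivalence_full shiftE v.
rewrite -(compm1 (fmap shift f)) -ji compmA vE -v'E (weight_orth v' lX gV).
by rewrite (fmap0 (@shift_additive C)) !comp0m.
Qed.

Definition D_le0 X := D X /\ le0 X.
Definition D_ge0 X := D X /\ ge0 X.

Lemma D_ge0_iso : iso_closed D_ge0.
Proof.
move=> X Y XY [DX lX]; split; first exact: (tsub_iso HD XY).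
exact: (ge0_iso XY).
Qed.

Lemma D_le0_star X : star D_le0 D_le0 X -> D_le0 X.
Proof.
move=> [A [B [f [g [h [d [DA lA] [DB lB]]]]]]]; split.
  exact: (tsub_ext HD d).
by apply: le0_star; exists A, B, f, g, h.
Qed.

Lemma D_ge0_star X : star D_ge0 D_ge0 X -> D_ge0 X.
Proof.
move=> [A [B [f [g [h [d [DA lA] [DB lB]]]]]]]; split.
  exact: (tsub_ext HD d).
by apply: ge0_star; exists A, B, f, g, h.
Qed.

Notation sorted := (star D_le0 D_ge0).

(* Reordering [L*H*L*H] as [L*L*H*H], where [L], [H] are the parts of
   weights at most and at least [0]. *)
Lemma sorted_star X : star sorted sorted X -> sorted X.
Proof.
have sw Y : star D_ge0 D_le0 Y -> sorted Y.
  apply: star_swap; first exact: D_ge0_iso.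
  by move=> A B [_ lA] [_ gB] f; exact: (weight_orth f lA gB).
move=> /star_assocl s.
have {s} : star D_le0 sorted X.
  apply: (star_mono _ _ s) => // A /star_assocr {}s.
  apply: (star_mono (fun _ => id) D_ge0_star); apply: star_assocl.
  exact: (star_mono sw (fun _ => id) s).
by move/star_assocr; apply: (star_mono D_le0_star).
Qed.

(* All shifts are quantified over at once in order to get a triangulated
   subcategory. *)
Lemma D_sorted X : D X -> sorted X.
Proof.
(* The isomorphism says that [E] is the shift of [X] by [m - n], which may be negative. *)
pose Q X := D X /\ forall E m n,
  isomorphic (iter m shift X) (iter n shift E) -> sorted E.
have DE X' E m n : D X' -> isomorphic (iter m shift X') (iter n shift E) -> D E.
  move=> DX XE; apply/(iter_tsub n _ HD); apply: (tsub_iso HD XE).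
  exact/(iter_tsub m _ HD).
have D0 := tsub_zero HD.
suff DQ Y : D Y -> Q Y.
  by move=> /DQ [_ /(_ X 0 0)]; apply; apply: isomorphic_refl.
move=> DY; apply: DY; first split.
- move=> A B AB [DA sA]; split; first exact: (tsub_iso HD AB).
  move=> E m n BE; apply: (sA E m n); apply: isomorphic_trans BE.
  exact: iter_shift_fmap_isomorphic.
- move=> Z Z0; split; first exact: D0.
  move=> E m n ZE.
  have E0 : is_zero E.
    by apply/(iter_shift_zero n); apply: zero_isomorphic ZE _; apply/iter_shift_zero.
  apply: star_zero_right; first by move=> Z' Z'0; split; [exact: D0|exact: ge0_zero].
  by split; [exact: D0|exact: le0_zero].
- move=> A; split=> -[DA sA]; split=> [|E m n AE].
  + exact: ((tsub_shift HD A).1 DA).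
  + by apply: (sA E m.+1 n); rewrite iterSr.
  + exact: ((tsub_shift HD A).2 DA).
  + apply: (sA E m n.+1); rewrite -iterSr !iterS.
    exact: (isomorphic_fmap shift).
- move=> A B Z f g h d [DA sA] [DB sB].
  split; first exact: (tsub_cone HD d DA DB).
  move=> E m n ZE; apply: sorted_star.
  have /dist_rotate d' := d.
  have ic V : iso_closed (isomorphic (C := C) V).
    by move=> ? ? h1 h2; apply: isomorphic_trans h2 h1.
  have : star (isomorphic (iter m shift B)) (isomorphic (iter m shift (shift A)))
      (iter n shift E).
    apply: star_iso ZE _; apply/star_iter_shift => //.
    exists B, (shift A), g, h, (- fmap shift f).
    by split=> //; apply: isomorphic_refl.
  move/(star_iter_shift _ _ (ic _) (ic _)); apply: star_mono => V.
    exact: sB.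
  by rewrite -iterSr; apply: sA.
move=> Z SZ.
have DZ : D Z by move=> D' HD' SD'; apply: SD'.
split=> // E m n ZE; have DE' := DE _ _ _ _ DZ ZE.
(* As cones have weights in [0, 1], a nonnegative shift of one has weight at least 0 and a negative
   shift has weight at most 0. Either way one of the two pieces can be zero. *)
case: (leqP n m) => [nm|mn].
  apply: star_zero_left; first by move=> Z' Z'0; split; [exact: D0|exact: le0_zero].
  split=> //; apply: (@ge0_iso _ _ (iter (m - n) shift Z)).
    by apply: (@iter_shift_isomorphic _ n); rewrite -iterD subnKC.
  by apply: ge0_iter_shift; apply: cones_ge0.
apply: star_zero_right; first by move=> Z' Z'0; split; [exact: D0|exact: ge0_zero].
(* One of the [n - m] shifts is kept for the desuspension in [cones_le1]. *)
split=> //; apply: (@le0_iter_unshift (n - m).-1).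
apply: cones_le1 SZ _; rewrite -iterS prednK ?subn_gt0 //.
apply: (@iter_shift_isomorphic _ m); rewrite -iterD subnKC 1?ltnW //.
exact: isomorphic_sym.
Qed.

(** The objects that are bounded below form a triangulated subcategory containing the cones. *)
Lemma D_bounded_below X : D X -> exists n, ge0 (iter n shift X).
Proof.
move=> DX; apply: (DX (fun A => exists n, ge0 (iter n shift A))); first split.
- move=> A B AB [n gA]; exists n; apply: ge0_iso gA.
  exact: iter_shift_fmap_isomorphic.
- by move=> Z Z0; exists 0; apply: ge0_zero.
- move=> A; split=> -[n gA].
    by exists n; rewrite -iterSr; apply: ge0_shift.
  by exists n.+1; rewrite iterSr.
- move=> A B Z f g h /dist_rotate d [m gA] [n gB]; exists (m + n)%N.
  apply: ge0_star; apply/star_iter_shift; try exact: ge0_iso.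
  exists B, (shift A), g, h, (- fmap shift f); split=> //.
    by rewrite iterD; apply: ge0_iter_shift.
  by rewrite -iterSr iterS addnC iterD; apply/ge0_shift/ge0_iter_shift.
by move=> Z /cones_ge0 gZ; exists 0.
Qed.

End GeneratedByHeartCones.

(** This tests a lower bound on [X] itself, against objects [M] whose shifts are controlled, so that
    no negative shift has to be chosen. *)
Lemma ge0_iter_char (C : triangulated_category) (w : weight_structure C) n
    (X : C) :
  w_ge0 w (iter n shift X) <->
  forall (M : C) (f : mor M X), w_le0 w (iter n.+1 shift M) -> f = 0.
Proof.
have shiftE := shift_equivalence C.
elim: n X => [|n IHn] X.
  split=> [gX M f lM|]; first exact: weight_orth_unshift lM gX.
  exact: ge0_char.
rewrite iterSr; apply: (iff_trans (IHn _)); split=> orth M f lM.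
  apply: (equivalence_faithful shiftE); rewrite (fmap0 (@shift_additive C)).
  by apply: orth; rewrite -iterSr.
have [M' [i [j [ji ij]]]] := equivalence_surj shiftE M.
have [g gE] := equivalence_full shiftE (f \c j).
rewrite -(compm1 f) -ji compmA -gE (orth _ g).
  by rewrite (fmap0 (@shift_additive C)) comp0m.
rewrite iterSr; apply: le0_iso lM.
by apply: (@iter_shift_fmap_isomorphic _ n.+1); exists i, j.
Qed.

(** * The quotient *)

Section Quotient.
Variables (C : triangulated_category) (w : weight_structure C).
Variable S : morphism_class (heart w).
Variables (C' : triangulated_category) (L : exact_functor C C').
Notation le0 := (w_le0 w).
Notation ge0 := (w_ge0 w).
Notation D := (strongly_generated (cones S)).
Notation W := (cone_in D).
Hypothesis hL : is_verdier_quotient D L.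
Let HD : triangulated_subcategory D := strongly_generated_triangulated (cones S).
Let shiftE := shift_equivalence C.
Let shiftE' := shift_equivalence C'.
Implicit Types X Y Z : C.

Let W_id := cone_in_id HD.
Let W_comp := cone_in_comp HD.
Let W_ore := cone_in_ore HD.
Let W_cancel := cone_in_left_cancellable HD.
Let loc : is_localization W L := proj1 hL.

Lemma quotient_fmap0 X Y (f : mor X Y) : fmap L f = 0 ->
  exists (T : C) (a : mor X T) (b : mor T Y), D T /\ f = b \c a.
Proof.
move=> f0; have [|T [s [ws e]]] := loc_eq W_id W_comp W_ore W_cancel loc (f := f) (g := 0).
  by rewrite f0 (fmap0 (@exact_additive _ _ L)).
by apply: (factor_through HD ws); rewrite e compm0.
Qed.

(* The part of nonpositive weight of the cone of [s] lifts to [M] by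
   orthogonality; [k] kills it. *)
Lemma fraction_into_ge0 Y M (s : mor Y M) : ge0 Y -> W s ->
  exists (M' : C) (k : mor M M'), W k /\ ge0 M'.
Proof.
move=> gY [Z [p [q [d DZ]]]].
have [A [B [i [t [r [di [DA lA] [DB gB]]]]]]] := D_sorted DZ.
have [|i' iE] := dist_lift (let: conj h _ := dist_rotate _ _ _ in h d) (u := i).
  exact: (weight_orth _ lA gY).
have [M' [k [j dk]]] := dist_cone i'.
have /dist_rotate d' := d; rewrite iE in di.
(* The octahedron on [i = p \c i'] makes [M'] an extension of [B] by [Y], whence its weight. *)
have [u [v [duv _ _ _ _]]] := dist_octahedron dk d' di.
exists M', k; split.
  have /dist_rotate dk' := dk.
  by do 3 eexists; split; [exact: dk'|exact: (tsub_shift HD A).1].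
have [Y' [a [b [dab YY']]]] := unrotate duv.
apply: ge0_star; exists Y', B, a, u, b; split=> //.
exact: ge0_iso (equivalence_reflects_isomorphic shiftE YY') gY.
Qed.

Lemma quotient_orth X Y (p : mor (L X) (L Y)) : le0 (shift X) -> ge0 Y -> p = 0.
Proof.
move=> lX gY.
have [_ roof] := loc_roof_surj W_id W_comp W_ore loc.
have [T [f [s [ws e]]]] := roof _ _ p.
have [M [k [wk gM]]] := fraction_into_ge0 gY ws.
apply: (iso_monic (loc_inverts loc ws)); apply: (iso_monic (loc_inverts loc wk)).
rewrite e -fmapM (weight_orth_unshift (k \c f) lX gM) !compm0.
exact: (fmap0 (@exact_additive _ _ L)).
Qed.

Definition quotient_le0 (X' : C') := exists X, le0 X /\ retract_of X' (L X).
Definition quotient_ge0 (X' : C') := exists X, ge0 X /\ retract_of X' (L X).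

Lemma exact_shift_isomorphic X : isomorphic (L (shift X)) (shift (L X)).
Proof. by exists (exact_shift L X); apply: exact_shift_iso. Qed.

Lemma quotient_le0_retract (X' Y' : C') :
  retract_of X' Y' -> quotient_le0 Y' -> quotient_le0 X'.
Proof.
by move=> XY [Y [lY YL]]; exists Y; split=> //; apply: retract_trans XY YL.
Qed.

Lemma quotient_ge0_retract (X' Y' : C') :
  retract_of X' Y' -> quotient_ge0 Y' -> quotient_ge0 X'.
Proof.
by move=> XY [Y [lY YL]]; exists Y; split=> //; apply: retract_trans XY YL.
Qed.

(** Desuspends [X'] together with its witness, because [quotient_orth] requires a source of negative
    weight. *)
Lemma quotient_le0_unshift (X' : C') : quotient_le0 X' ->
  exists (Y' : C') (Y : C),
    [/\ isomorphic X' (shift Y'), le0 (shift Y) & retract_of Y' (L Y)].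
Proof.
move=> [X [lX XL]]; have [Y XY] := equivalence_surj shiftE X.
have [Y' XY'] := equivalence_surj shiftE' X'.
exists Y', Y; split=> //; first exact: le0_iso XY lX.
apply: (equivalence_reflects_retract shiftE').
apply: retract_trans (isomorphic_retract (isomorphic_sym XY')) _.
apply: retract_trans XL (isomorphic_retract _).
apply: isomorphic_trans (isomorphic_fmap L XY) _.
exact: exact_shift_isomorphic.
Qed.

Lemma quotient_le0_shift (X' : C') :
  quotient_le0 X' -> shift_class quotient_le0 X'.
Proof.
move=> /quotient_le0_unshift [Y' [Y [XY' lY YL]]].
by exists Y'; split=> //; exists Y; split=> //; apply: le0_unshift.
Qed.

Lemma quotient_ge0_shift (X' : C') :
  shift_class quotient_ge0 X' -> quotient_ge0 X'.
Proof.
move=> [Y' [[Y [gY YL]] XY']]; exists (shift Y); split; first exact: ge0_shift.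
apply: retract_trans (isomorphic_retract XY') _.
apply: retract_trans (retract_fmap shift YL) (isomorphic_retract _).
by apply: isomorphic_sym; apply: exact_shift_isomorphic.
Qed.

Lemma quotient_orthogonal (X' Y' : C') : quotient_le0 X' ->
  shift_class quotient_ge0 Y' -> forall f : mor X' Y', f = 0.
Proof.
move=> /quotient_le0_unshift [X1 [X0 [[a [a' [a'a _]]] lX [i [p pi1]]]]].
move=> [Y1 [[Y0 [gY [j [q qj1]]]] [b [b' [b'b _]]]]] f.
(* [f] is desuspended to [g], which is a retract of the morphism [j \c g \c p] between images of
   objects of [C]. *)
have [g gE] := equivalence_full shiftE' (b \c f \c a').
have g0 : g = 0.
  have -> : g = q \c (j \c g \c p) \c i.
    by rewrite -!compmA pi1 compm1 compmA qj1 comp1m.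
  by rewrite (quotient_orth (j \c g \c p) lX gY) compm0 comp0m.
rewrite -(comp1m f) -b'b -(compm1 (_ \c f)) -a'a.
have -> : b' \c b \c f \c (a' \c a) = b' \c (b \c f \c a') \c a.
  by rewrite !compmA.
by rewrite -gE g0 (fmap0 (@shift_additive C')) compm0 comp0m.
Qed.

Lemma quotient_decomposition (M' : C') :
  exists (X' Y' : C') (f : mor X' M') (g : mor M' Y') (h : mor Y' (shift X')),
    [/\ dist f g h, quotient_le0 X' & shift_class quotient_ge0 Y'].
Proof.
have [surj _] := loc_roof_surj W_id W_comp W_ore loc.
have [M MM] := surj M'.
have [X [Y [f [g [h [d lX [Y0 [gY YY]]]]]]]] := w_decomposition w M.
have [f' [g' [h' d']]] := dist_iso_objects (exact_dist L d)
  (isomorphic_refl _) (isomorphic_sym MM) (isomorphic_refl _).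
exists (L X), (L Y), f', g', h'; split=> //.
  by exists X; split=> //; apply/isomorphic_retract/isomorphic_refl.
exists (L Y0); split.
  by exists Y0; split=> //; apply/isomorphic_retract/isomorphic_refl.
apply: isomorphic_trans (isomorphic_fmap L YY) _.
exact: exact_shift_isomorphic.
Qed.

Definition quotient_weight : weight_structure C' :=
  WeightStructure quotient_le0_retract quotient_ge0_retract quotient_le0_shift
    quotient_ge0_shift quotient_orthogonal quotient_decomposition.

Lemma quotient_weight_descends : descends_to w L quotient_weight.
Proof.
by split=> X wX; exists X; split=> //; apply/isomorphic_retract/isomorphic_refl.
Qed.

(** Up to [exact_shift], the image of [h] goes from weight at most 0 to weight at least 1 in the
    quotient. *)
Lemma quotient_kills_connecting X A (h : mor A (shift X)) :
  le0 A -> quotient_ge0 (L X) -> fmap L h = 0.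
Proof.
move=> lA gX; apply: (iso_monic (exact_shift_iso L X)); rewrite compm0.
apply: (@weight_orth C' quotient_weight) => //.
exact: quotient_weight_descends.1.
Qed.

(* The connecting morphism of a weight decomposition of [X] vanishes in the
   quotient, so it factors through an object of [D], and these are bounded. *)
Lemma bounded_below_of_quotient_ge0 X :
  quotient_ge0 (L X) -> exists n, ge0 (iter n shift X).
Proof.
move=> gX; have [Y [A [f [g [h [d gY lA]]]]]] := weight_dec w X.
have [T [a [b [DT hE]]]] := quotient_fmap0 (quotient_kills_connecting h lA gX).
have [n gT] := D_bounded_below DT.
(* One more than the bound of [T]: the test morphism is shifted once before it is lifted to [A] and
   sent on to [T]. *)
exists n.+1; apply/ge0_iter_char => M u lM.
apply: (equivalence_faithful shiftE); rewrite (fmap0 (@shift_additive C)).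
have /dist_rotate/dist_rotate d' := d.
have lM1 : le0 (shift M).
  by apply: (@le0_iter_unshift _ _ n.+1); rewrite -iterSr.
have [|v ->] := dist_lift d' (u := fmap shift u).
  by rewrite compNm -fmapM (weight_orth_unshift (f \c u) lM1 gY)
    (fmap0 (@shift_additive C)) oppr0.
rewrite hE -compmA ((ge0_iter_char w n T).1 gT _ (a \c v)) ?compm0 //.
by rewrite -iterSr.
Qed.

(* In the quotient [e] has a section, [L(s)^-1 L(f)] with [s : Y -> M] and
   [M] of nonnegative weight. If [e'] is the pushout of [e] along [s], then
   [e' f] agrees in the quotient with a morphism whose cone is in [D], hence its
   own cone is in [D], although [D] need not be closed under retracts. The
   octahedron on [e' f] compares [X] with the cone of [f]. *)
Lemma lifting_step X : ge0 (shift X) -> quotient_ge0 (L X) -> star D ge0 X.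
Proof.
move=> gX gLX; have [Y [A [y [e [i [d gY lA]]]]]] := weight_dec w X.
have Li0 := quotient_kills_connecting i lA gLX.
have [|r rE] := dist_lift (let: conj h _ := dist_rotate _ _ _ in h (exact_dist L d))
    (u := idmor (L A)); first by rewrite Li0 compm0 comp0m.
have [_ roof] := loc_roof_surj W_id W_comp W_ore loc.
have [M0 [f0 [s0 [ws0 e0]]]] := roof _ _ r.
have [M [k [wk gM]]] := fraction_into_ge0 gY ws0.
pose s := k \c s0; pose f := k \c f0.
have [B [p [q [ds DB]]]] : W s by apply: W_comp.
have fE : fmap L s \c r = fmap L f by rewrite /s /f !fmapM -compmA e0.
have [P [e' [n dP]]] := dist_cone (s \c y).
have [j [v [dj jE _ _ _]]] := dist_octahedron d ds dP.
(* [j] is the pushout of [s] along [e] and has the same cone [B] as [s]. *)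
have wj : W j by exists B, v, (fmap shift e \c q).
(* In the quotient, [e' f = e' s r = j e r = j]. *)
have [|V [t [wt tE]]] := loc_eq W_id W_comp W_ore W_cancel loc (f := e' \c f) (g := j).
  by rewrite fmapM -fE compmA -fmapM -jE fmapM -compmA -rE compm1.
have [E [m [l [dE DE]]]] : W (e' \c f).
  by apply: (cone_in_compK HD wt); rewrite tE; apply: W_comp.
have [N [c [o df]]] := dist_cone f.
have /dist_rotate dP' := dP.
have [a [b [dab _ _ _ _]]] := dist_octahedron df dP' dE.
have wN : W (c \c (s \c y)).
  exists E, a, b; split=> //; apply/dist_rotate.
  by move: dab; rewrite compmN -fmapM.
(* The lower bound on [X] enters here: [A] is an extension of [shift X] by [Y], and [N] is one of
   [shift A] by [M]. *)
have gA : ge0 A.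
  have /dist_rotate d' := d; apply: ge0_star; exists Y, (shift X), e, i; eexists.
  by split; [exact: d'|exact: gY|exact: gX].
have gN : ge0 N.
  have /dist_rotate df' := df; apply: ge0_star; exists M, (shift A), c, o; eexists.
  by split; [exact: df'|exact: gM|exact: ge0_shift].
by have [T [x [z [dT DT]]]] := cone_in_fiber HD wN; exists T, N, x, (c \c (s \c y)), z.
Qed.

(** Applied to the [n]-th shift of [X], [lifting_step] splits off an object of [D] and leaves [Y]
    with a bound better by one. The images of [X] and [Y] agree in the quotient, so induction
    applies to [Y], and the pieces in [D] combine by associativity of [star]. *)
Lemma lifting n X :
  ge0 (iter n shift X) -> quotient_ge0 (L X) -> star D ge0 X.
Proof.
elim: n X => [|n IHn] X gX gLX.
  by apply: star_zero_left gX; apply: tsub_zero HD.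
have gLn : quotient_ge0 (L (iter n shift X)).
  elim: {IHn gX} n => //= n IHn; apply: quotient_ge0_shift.
  by exists (L (iter n shift X)); split=> //; apply: exact_shift_isomorphic.
have := lifting_step gX gLn.
move/(star_iter_shift _ _ (tsub_iso HD) (@ge0_iso _ w)).
move=> [T [Y [f [g [h [d /(iter_tsub n _ HD) DT gY]]]]]].
have Lg : is_iso (fmap L g).
  have /dist_rotate d' := d; apply: (loc_inverts loc).
  by exists (shift T), h, (- fmap shift f); split=> //; apply: (tsub_shift HD T).1.
have sY : star D ge0 Y.
  apply: IHn gY _; apply: quotient_ge0_retract gLX.
  by apply/isomorphic_retract/isomorphic_sym; exists (fmap L g).
have : star D (star D ge0) X by exists T, Y, f, g, h.
move=> /star_assocr; apply: (star_mono _ (fun _ => id)) => Z.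
by move=> [A [B [? [? [? [dZ DA DB]]]]]]; apply: (tsub_ext HD dZ).
Qed.

End Quotient.

Theorem theorem3p3p1 (C : triangulated_category) (w : weight_structure C)
    (S : morphism_class (heart w)) (hS : left_ore S)
    (C' : triangulated_category) (L : exact_functor C C')
    (hL : is_verdier_quotient (strongly_generated (cones S)) L) :
  left_weight_lifting w (strongly_generated (cones S)) L.
Proof.
exists (quotient_weight hL); split; first exact: quotient_weight_descends.
move=> X gX; have [n gn] := bounded_below_of_quotient_ge0 hL gX.
exact: (lifting hL gn gX).
Qed.
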